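(* Let $k\in\mathbb{N}$ and let $G$ denote $k$-pile Nim. Then $G^{\star\star}=G$, that is, $\mathcal{M}(G^{\star\star})=\mathcal{M}(G)$ (so $G^\star$ is the dual game of $k$-pile Nim).
   Context: $\mathbb{N}=\{1,2,3,\dots\}$, $\mathbb{N}_0=\{0,1,2,\dots\}$. An invariant subtraction game $G$ on $\mathbb{N}_0^k$ is given by a set of moves $\mathcal{M}(G)\subseteq\mathbb{N}_0^k\setminus\{\boldsymbol 0\}$; from position $\boldsymbol x\in\mathbb{N}_0^k$ the options are all $\boldsymbol x-\boldsymbol m$ with $\boldsymbol m\in\mathcal{M}(G)$ and $\boldsymbol m\le\boldsymbol x$ coordinatewise. Two players alternate and a player who cannot move loses. A position is $P$ if all its options are $N$ (in particular if it has no options) and is $N$ if it has at least one $P$ option; $\mathcal{P}(G)$ is the set of $P$-positions. The game $G^\star$ is defined by $\mathcal{M}(G^\star)=\mathcal{P}(G)\setminus\{\boldsymbol 0\}$ (on the same board), and $G^{\star\star}=(G^\star)^\star$. If $G=G^{\star\star}$, then $G^\star$ is called the dual of $G$. $k$-pile Nim is the game whose moves are all $k$-tuples in $\mathbb{N}_0^k$ with exactly one non-zero coordinate. *)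

(* Defs.v *)
From mathcomp Require Import all_boot.
From mathcomp Require Import boolp classical_sets.

Set Implicit Arguments.
Unset Strict Implicit.
Unset Printing Implicit Defensive.

Local Open Scope classical_set_scope.

Definition position (k : nat) := {ffun 'I_k -> nat}.

Definition zerop (k : nat) : position k := [ffun=> 0].

Definition lep (k : nat) (m x : position k) : Prop := forall i, m i <= x i.

(* Truncated coordinatewise; [subp x m] is only used when [lep m x]. *)
Definition subp (k : nat) (x m : position k) : position k :=
  [ffun i => x i - m i].

Record game (k : nat) := Game {
  moves : set (position k);
  moves_neq0 : ~ moves (zerop k)
}.

Definition options (k : nat) (G : game k) (x : position k) : set (position k) :=
  [set y | exists m, [/\ moves G m, lep m x & y = subp x m]].

(* Every move lowers the sum of the coordinates, so play terminates and this
   mutual induction assigns exactly one of the two outcomes to each position. *)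
Inductive is_P (k : nat) (G : game k) (x : position k) : Prop :=
  | is_P_intro : (forall y, options G x y -> is_N G y) -> is_P G x
with is_N (k : nat) (G : game k) (x : position k) : Prop :=
  | is_N_intro y : options G x y -> is_P G y -> is_N G x.

Definition Ppositions (k : nat) (G : game k) : set (position k) :=
  [set x | is_P G x].

Lemma star_moves_neq0 (k : nat) (G : game k) :
  ~ (Ppositions G `\ zerop k) (zerop k).
Proof. by case=> _; apply. Qed.

Definition star (k : nat) (G : game k) : game k :=
  Game (@star_moves_neq0 k G).

Definition nim_moves (k : nat) : set (position k) :=
  [set m | exists! i, m i != 0].

Lemma nim_moves_neq0 (k : nat) : ~ nim_moves (zerop k).
Proof. by case=> i [] /=; rewrite ffunE. Qed.

Definition nim (k : nat) : game k := Game (@nim_moves_neq0 k).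

(* Main.v *)
Require Import Defs.
From mathcomp Require Import all_boot.
From mathcomp Require Import boolp classical_sets.

(** Write [G] for [k]-pile Nim.  The theorem says that the nonzero P-positions
    of [star G] are exactly the Nim moves, i.e. the positions with exactly one
    nonempty pile.  Neither the nim-sum nor any description of the P-positions
    of [G] is needed.

    A position with one nonempty pile is terminal in [star G]: a nonzero
    position below it is again a Nim move, hence an N-position of [G] (play it
    to reach zero), so it is not a move of [star G]
    ([is_P_star_nim_of_move]).

    Conversely, let [x] be a nonzero position that is not a Nim move.  If [x]
    is a P-position of [G], then [x] is itself a move of [star G], leading to
    zero.  Otherwise some Nim move [m] leads from [x] to a P-position [x - m]
    of [G]; it is nonzero because [x] is not [m], so it is a move of [star G],
    and it leads from [x] to [m], which is a P-position of [star G] by the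
    first part.  Either way [x] is an N-position of [star G]
    ([is_N_star_nim]). *)

(** Proved by mutual recursion on the two derivations: the option witnessing
    the N-position carries both a smaller P-derivation and, through the
    P-position, a smaller N-derivation. *)
Lemma is_P_is_N_False k (G : game k) x : is_P G x -> is_N G x -> False.
Proof.
move: x.
refine (fix F x (p : is_P G x) {struct p} : is_N G x -> False :=
          match p with is_P_intro H => fun n =>
            match n with is_N_intro y o Py => F' y (H y o) Py end end
        with F' x (n : is_N G x) {struct n} : is_P G x -> False :=
          match n with is_N_intro y o Py => fun p =>
            match p with is_P_intro H => F y Py (H y o) end end
        for F).
Qed.

Lemma is_P_zerop k (G : game k) : is_P G (zerop k).
Proof.
split=> y [m [mG m0 _]]; case: (@moves_neq0 _ G).
suff <- : m = zerop k by [].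
by apply/ffunP => i; apply/eqP; have := m0 i; rewrite !ffunE leqn0.
Qed.

Lemma sum_option_lt k (G : game k) x y :
  options G x y -> \sum_i y i < \sum_i x i.
Proof.
move=> [m [mG mx ->]].
have -> : \sum_i x i = \sum_i subp x m i + \sum_i m i.
  by rewrite -big_split; apply: eq_bigr => i _ /=; rewrite ffunE subnK.
rewrite -[X in X < _]addn0 ltn_add2l lt0n; apply/negP => /eqP/eqP.
rewrite sum_nat_eq0 => /forallP m0; apply: (@moves_neq0 _ G).
suff <- : m = zerop k by [].
by apply/ffunP => i; rewrite ffunE; apply/eqP; apply: m0.
Qed.

(** Determinacy, by induction on the sum of the coordinates. *)
Lemma is_P_or_is_N k (G : game k) x : is_P G x \/ is_N G x.
Proof.
have [n] := ubnP (\sum_i x i); elim: n x => // n IHn x; rewrite ltnS => xn.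
have [[y [oy Py]]|noP] := pselect (exists y, options G x y /\ is_P G y).
  by right; exact: (is_N_intro oy).
left; split=> y oy; have [Py|//] := IHn y (leq_trans (sum_option_lt _ _ _ _ oy) xn).
by case: noP; exists y.
Qed.

Lemma lep_refl k (x : position k) : lep x x.
Proof. by move=> i. Qed.

Lemma subpp k (x : position k) : subp x x = zerop k.
Proof. by apply/ffunP => i; rewrite !ffunE subnn. Qed.

Lemma subp0 k (x : position k) : subp x (zerop k) = x.
Proof. by apply/ffunP => i; rewrite !ffunE subn0. Qed.

Lemma lep_subp k (x m : position k) : lep (subp x m) x.
Proof. by move=> i; rewrite ffunE leq_subr. Qed.

Lemma subKp k (x m : position k) : lep m x -> subp x (subp x m) = m.
Proof. by move=> mx; apply/ffunP => i; rewrite !ffunE subKn. Qed.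

Lemma is_N_move k (G : game k) m : moves G m -> is_N G m.
Proof.
move=> mG; apply: is_N_intro (is_P_zerop k G).
by exists m; rewrite subpp; split=> //; exact: lep_refl.
Qed.

Lemma nim_moves_lep k (x m : position k) :
  nim_moves x -> lep m x -> m <> zerop k -> nim_moves m.
Proof.
move=> [i [_ xi]] mx m0.
have mi j : m j != 0 -> i = j.
  by move=> mj; apply: xi; rewrite -lt0n (leq_trans _ (mx j)) // lt0n.
exists i; split=> //; apply: contra_notN m0 => /eqP mi0.
apply/ffunP => j; rewrite ffunE; apply/eqP; apply/negPn/negP => mj.
by move: (mj); rewrite -(mi j mj) mi0.
Qed.

Lemma is_P_star_nim_of_move k (x : position k) :
  nim_moves x -> is_P (star (nim k)) x.
Proof.
move=> xnim; split=> y [m [[Pm m0] mx _]]; exfalso.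
apply: (is_P_is_N_False _ _ _ Pm); apply: is_N_move.
exact: nim_moves_lep xnim mx m0.
Qed.

Lemma is_N_star_nim k (x : position k) :
  x <> zerop k -> ~ nim_moves x -> is_N (star (nim k)) x.
Proof.
move=> x0 xnim; have [Px|[y [m [mnim mx ->]] Py]] := is_P_or_is_N _ (nim k) x.
  exact: is_N_move.
apply: (is_N_intro (y := m)); last exact: is_P_star_nim_of_move.
exists (subp x m); split; [split=> // xm0 | exact: lep_subp | by rewrite subKp].
by apply: xnim; rewrite -(subp0 _ x) -xm0 subKp.
Qed.

Lemma moves_star_star_nim k : moves (star (star (nim k))) = moves (nim k).
Proof.
apply/seteqP; split=> x.
  move=> [Px x0]; apply: contrapT => xnim.
  exact: is_P_is_N_False Px (is_N_star_nim _ _ x0 xnim).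
move=> xnim; split; first exact: is_P_star_nim_of_move.
by move=> x0; apply: (@nim_moves_neq0 k); rewrite -x0.
Qed.

(** The second field of a game is a proof, so its moves determine it. *)
Lemma game_eq k (G H : game k) : moves G = moves H -> G = H.
Proof.
case: G H => [M M0] [M' M'0] /= eqM; case: _ / eqM in M'0 *.
by congr Game; exact: Prop_irrelevance.
Qed.

Theorem theorem8 (k : nat) (hk : 0 < k) :
  star (star (nim k)) = nim k /\
  moves (star (star (nim k))) = moves (nim k).
Proof.
by split; [apply: game_eq|]; exact: moves_star_star_nim.
Qed.
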